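(* Let $L_m$ be the free Lie algebra of rank $m\ge 2$ over a field $K$ of characteristic $0$ with free generators $y_1,\ldots,y_m$. Then $L_m$ does not have nontrivial normal automorphisms; that is, the only normal automorphism of $L_m$ is the identity.
   Context: An automorphism $\varphi$ of an algebra $R$ is called normal if $\varphi(I)=I$ for every (two-sided) ideal $I$ of $R$. *)

(* Defs.v *)
From HB Require Import structures.
From mathcomp Require Import all_boot all_order all_algebra.
From mathcomp Require Import classical_sets.

Set Implicit Arguments.
Unset Strict Implicit.
Unset Printing Implicit Defensive.

Import GRing.Theory.
Local Open Scope ring_scope.

HB.mixin Record isLieAlgebra (K : fieldType) L & GRing.Lmodule K L := {
  lie : L -> L -> L;
  lie_linearl : forall (a : K) (x x' y : L),
    lie (a *: x + x') y = a *: lie x y + lie x' y;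
  lie_linearr : forall (a : K) (x y y' : L),
    lie x (a *: y + y') = a *: lie x y + lie x y';
  liexx : forall x : L, lie x x = 0;
  lie_jacobi : forall x y z : L,
    lie x (lie y z) + lie y (lie z x) + lie z (lie x y) = 0
}.

#[short(type="lieAlgType")]
HB.structure Definition LieAlgebra (K : fieldType) :=
  { L of GRing.Lmodule K L & isLieAlgebra K L }.

Definition lie_morphism (K : fieldType) (L M : lieAlgType K)
    (f : {linear L -> M}) : Prop :=
  forall x y : L, f (lie x y) = lie (f x) (f y).

Definition free_lie_algebra (K : fieldType) (m : nat) (L : lieAlgType K)
    (y : 'I_m -> L) : Prop :=
  forall (M : lieAlgType K) (z : 'I_m -> M),
    exists2 f : {linear L -> M},
      lie_morphism f /\ (forall i, f (y i) = z i)
    & forall g : {linear L -> M},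
        lie_morphism g -> (forall i, g (y i) = z i) -> g =1 f.

Definition lie_automorphism (K : fieldType) (L : lieAlgType K)
    (phi : {linear L -> L}) : Prop :=
  lie_morphism phi /\ bijective phi.

Definition lie_ideal (K : fieldType) (L : lieAlgType K) (I : set L) : Prop :=
  [/\ I 0,
      forall (a : K) (u v : L), I u -> I v -> I (a *: u + v)
    & forall x u : L, I u -> I (lie x u) /\ I (lie u x)].

Definition normal_automorphism (K : fieldType) (L : lieAlgType K)
    (phi : {linear L -> L}) : Prop :=
  lie_automorphism phi /\
  forall I : set L, lie_ideal I -> (phi @` I)%classic = I.

(* Main.v *)
Require Import Defs.
From HB Require Import structures.
From mathcomp Require Import all_boot all_order all_algebra.
From mathcomp Require Import boolp classical_sets.
From mathcomp Require Import finmap.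
From mathcomp.multinomials Require Import monalg.

Set Implicit Arguments.
Unset Strict Implicit.
Unset Printing Implicit Defensive.

Import GRing.Theory.
Local Open Scope ring_scope.

(** Fix a ring homomorphism from the free associative algebra on the
    generators to an algebra [A] without zero divisors whose only units are
    the scalars; let [rho : L -> A] be the induced representation of the free
    Lie algebra [L] and [J] its kernel.  Applying a Fox derivative and then the
    homomorphism gives [d : L -> A] with
      [d [u, v] = d u * rho v - d v * rho u].
    For [u] in [J] the set of [v] in [J] with [d v] in [d u * A] is an ideal, so
    for a normal automorphism [phi] the elements [d u] and [d (phi u)] are right
    multiples of each other; if they are not zero, the factor between them is a
    unit, hence a scalar.  A linear map that is pointwise scalar is scalar, so
    [d (phi u) = c * d u] on [J] for one constant [c].  Comparing the values on [u] and on [[u, x]] gives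
    [d u * rho x = d u * rho (phi x)], so [rho (phi x) = rho x] for all [x] as
    soon as [d] does not vanish on [J]
    (lemma [normal_automorphism_fixes_image]).

    It remains to find enough such representations.  Take for [A] the skew
    polynomials in [t] over [K[X]] with [t * q(X) = q(X + 1) * t], and send the
    generator [y_i] to [p_i * t], with [p_0 = 1].  The element obtained from
    [y_1] by bracketing [n] times with [y_0] is sent to an [n]-th finite
    difference of [p_1] times a power of [t], which is [0] for large [n],
    whereas [d], formed with the Fox derivative for [y_1], sends it to
    [t ^ n]; so [d] does not vanish on the kernel ([shift_rep_kernel]).
    The other [p_i] are arbitrary polynomials, hence by interpolation their
    values at finitely many integers are arbitrary, and this is enough to
    detect any nonzero noncommutative polynomial ([shift_eval_separates]).

    Consequently [phi x] and [x] agree in the free associative algebra, and [L]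
    embeds in it: the map that replaces a word by the iterated bracket of its
    letters yields a derivation of [L] that depends only on the image in the
    free associative algebra and that multiplies a bracket of [n] generators by
    [n], so it is injective in characteristic zero ([iota_inj]). *)

(** * Lie brackets and induction on a free Lie algebra *)

Section LieTheory.
Variables (K : fieldType) (L : lieAlgType K).
Implicit Types x y z : L.

Fact lie_is_linear x : linear (lie x).
Proof. by move=> a y y'; apply: lie_linearr. Qed.
HB.instance Definition _ x := GRing.isLinear.Build K L L *:%R (lie x) (lie_is_linear x).

Lemma lieDl x x' y : lie (x + x') y = lie x y + lie x' y.
Proof. by rewrite -[x]scale1r lie_linearl !scale1r. Qed.

Lemma lie0l y : lie 0 y = 0 :> L.
Proof. by apply: (addrI (lie 0 y)); rewrite -lieDl !addr0. Qed.

Lemma lieZl a x y : lie (a *: x) y = a *: lie x y.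
Proof. by rewrite -[a *: x]addr0 lie_linearl lie0l addr0. Qed.

Lemma lieNl x y : lie (- x) y = - lie x y.
Proof. by rewrite -scaleN1r lieZl scaleN1r. Qed.

Lemma lieC x y : lie x y = - lie y x.
Proof.
apply/eqP; rewrite -addr_eq0; have := liexx (x + y).
by rewrite linearD /= !lieDl !liexx add0r addr0 addrC => ->.
Qed.

Lemma lie_suml I (r : seq I) (F : I -> L) y :
  lie (\sum_(i <- r) F i) y = \sum_(i <- r) lie (F i) y.
Proof. exact: (big_morph (fun x => lie x y) (fun x x' => lieDl x x' y) (lie0l y)). Qed.

Lemma lie_lier x y z : lie x (lie y z) = lie (lie x y) z - lie (lie x z) y.
Proof.
have := lie_jacobi x y z.
rewrite (lieC y (lie z x)) (lieC z (lie x y)) (lieC z x) lieNl opprK => /eqP.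
by rewrite subr_eq0 => /eqP <-; rewrite addrK.
Qed.
End LieTheory.

(** The elements that satisfy a closed property form a Lie subalgebra [S].  If
    [S] contains the generators, the identity of [L] and the composite of the
    induced map [L -> S] with the inclusion agree on them, hence are equal. *)
Section InductionPrinciple.
Variables (K : fieldType) (L : lieAlgType K) (P : L -> Prop).
Hypothesis P0 : P 0.
Hypothesis Plin : forall (a : K) u v, P u -> P v -> P (a *: u + v).
Hypothesis Plie : forall u v, P u -> P v -> P (lie u v).

Definition lie_subalg : {pred L} := fun x => `[< P x >].

Fact lie_subalg_submod_closed : submod_closed lie_subalg.
Proof.
split=> [|a u v /asboolP Pu /asboolP Pv]; apply/asboolP => //.
exact: Plin.
Qed.
HB.instance Definition _ :=
  GRing.isSubmodClosed.Build K L lie_subalg lie_subalg_submod_closed.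

Record lie_subalg_type := LieSubalg { lie_subalg_val : L; _ : lie_subalg_val \in lie_subalg }.
HB.instance Definition _ := [isSub for lie_subalg_val].
HB.instance Definition _ := [Choice of lie_subalg_type by <:].
HB.instance Definition _ := [SubChoice_isSubLmodule of lie_subalg_type by <:].

Fact lie_subalg_closed (u v : lie_subalg_type) :
  lie (val u) (val v) \in lie_subalg.
Proof. by case: u v => [u uP] [v vP]; apply/asboolP/Plie; apply/asboolP. Qed.

Definition sub_lie u v := LieSubalg (lie_subalg_closed u v).

Fact val_sub_lie u v : val (sub_lie u v) = lie (val u) (val v).
Proof. by []. Qed.

Fact sub_lie_linearl (a : K) x x' y :
  sub_lie (a *: x + x') y = a *: sub_lie x y + sub_lie x' y.
Proof. by apply: val_inj; rewrite [RHS]linearP !val_sub_lie linearP lie_linearl. Qed.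

Fact sub_lie_linearr (a : K) x y y' :
  sub_lie x (a *: y + y') = a *: sub_lie x y + sub_lie x y'.
Proof. by apply: val_inj; rewrite [RHS]linearP !val_sub_lie !linearP. Qed.

Fact sub_liexx x : sub_lie x x = 0.
Proof. by apply: val_inj; rewrite val_sub_lie liexx. Qed.

Fact sub_lie_jacobi x y z :
    sub_lie x (sub_lie y z) + sub_lie y (sub_lie z x) + sub_lie z (sub_lie x y) = 0.
Proof. by apply: val_inj; rewrite /= lie_jacobi. Qed.
HB.instance Definition _ := isLieAlgebra.Build K lie_subalg_type
  sub_lie_linearl sub_lie_linearr sub_liexx sub_lie_jacobi.

Lemma closed_property_full m (y : 'I_m -> L) :
  free_lie_algebra y -> (forall i, P (y i)) -> forall u, P u.
Proof.
move=> freeL Py u.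
have Py' i : y i \in lie_subalg by apply/asboolP.
have [f [f_mor fy] _] := freeL lie_subalg_type (fun i => LieSubalg (Py' i)).
have [g _ g_uniq] := freeL L y.
pose vf : {linear L -> L} := (val : {linear lie_subalg_type -> L}) \o f.
have -> : u = val (f u).
  rewrite -[LHS]/(idfun u) (g_uniq idfun) //.
  rewrite -[RHS]/(vf u) (g_uniq vf) // => [a b|i] /=; first by rewrite f_mor.
  by rewrite fy.
by case: (f u) => v vP; apply/asboolP.
Qed.
End InductionPrinciple.

Lemma free_lie_ind (K : fieldType) (L : lieAlgType K) m (y : 'I_m -> L)
    (freeL : free_lie_algebra y) (P : L -> Prop) :
  P 0 -> (forall (a : K) u v, P u -> P v -> P (a *: u + v)) ->
  (forall u v, P u -> P v -> P (lie u v)) -> (forall i, P (y i)) -> forall u, P u.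
Proof. by move=> P0 Plin Plie; apply: closed_property_full. Qed.

(** * The free associative algebra and its Fox derivatives *)

Section Commutator.
Variables (K : fieldType) (A : algType K).
Implicit Types f g h : A.

Lemma mul_linearl (a : K) f f' g : (a *: f + f') * g = a *: (f * g) + f' * g.
Proof. by rewrite mulrDl scalerAl. Qed.

Lemma mul_linearr (a : K) f g g' : f * (a *: g + g') = a *: (f * g) + f * g'.
Proof. by rewrite mulrDr scalerAr. Qed.

Definition commutator f g : A := f * g - g * f.

Fact commutatorC f g : commutator f g = - commutator g f.
Proof. by rewrite /commutator opprB. Qed.

Fact commutator_linearl (a : K) f f' g :
  commutator (a *: f + f') g = a *: commutator f g + commutator f' g.
Proof.
rewrite /commutator mulrDl mulrDr -scalerAl -scalerAr scalerBr opprD.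
exact: addrACA.
Qed.

Fact commutator_linearr (a : K) f g g' :
  commutator f (a *: g + g') = a *: commutator f g + commutator f g'.
Proof. by rewrite !(commutatorC f) commutator_linearl opprD scalerN. Qed.

Fact commutatorxx f : commutator f f = 0.
Proof. exact: subrr. Qed.

Fact commutator_jacobi f g h :
  commutator f (commutator g h) + commutator g (commutator h f)
  + commutator h (commutator f g) = 0.
Proof.
have sub2 (a b c d : A) : a - b - (c - d) = a - c - (b - d).
  by rewrite !opprD addrACA.
rewrite /commutator !mulrBl !mulrBr !mulrA.
have sum3 (a b c a' b' c' : A) :
    a - a' + (b - b') + (c - c') = a + b + c - (a' + b' + c').
  by rewrite (addrACA a) (addrACA (a + b)) -!opprD.
rewrite (sub2 (f * g * h)) (sub2 (g * h * f)) (sub2 (h * f * g)) sum3 !subrKA subrr add0r.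
by rewrite [X in X + _]addrC subrKA addrC subrKA subrr oppr0.
Qed.

Definition commutator_algebra : Type := A.
HB.instance Definition _ := GRing.Lmodule.on commutator_algebra.
HB.instance Definition _ := isLieAlgebra.Build K commutator_algebra
  commutator_linearl commutator_linearr commutatorxx commutator_jacobi.
End Commutator.

(** By bilinearity, multiplicativity and the Fox product rule need only be
    verified on words; these are the induction steps. *)
Section BilinearRules.
Variables (K : fieldType) (A B : algType K).

Lemma multiplicative_linl (e : {linear A -> B}) (a : K) f f' g :
  e (f * g) = e f * e g -> e (f' * g) = e f' * e g ->
  e ((a *: f + f') * g) = e (a *: f + f') * e g.
Proof. by move=> ef ef'; rewrite mul_linearl !linearP /= ef ef' mul_linearl. Qed.

Lemma multiplicative_linr (e : {linear A -> B}) (a : K) f g g' :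
  e (f * g) = e f * e g -> e (f * g') = e f * e g' ->
  e (f * (a *: g + g')) = e f * e (a *: g + g').
Proof. by move=> eg eg'; rewrite mul_linearr !linearP /= eg eg' mul_linearr. Qed.

Lemma fox_rule_linl (d : {linear A -> A}) (e : {scalar A}) (a : K) f f' g :
  d (f * g) = d f * g + e f *: d g -> d (f' * g) = d f' * g + e f' *: d g ->
  d ((a *: f + f') * g) = d (a *: f + f') * g + e (a *: f + f') *: d g.
Proof.
move=> df df'; rewrite mul_linearl !linearP /= df df' mul_linearl.
by rewrite scalerDl -scalerA scalerDr addrACA.
Qed.

Lemma fox_rule_linr (d : {linear A -> A}) (e : {scalar A}) (a : K) f g g' :
  d (f * g) = d f * g + e f *: d g -> d (f * g') = d f * g' + e f *: d g' ->
  d (f * (a *: g + g')) = d f * (a *: g + g') + e f *: d (a *: g + g').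
Proof.
move=> dg dg'; rewrite mul_linearr !linearP /= dg dg' mul_linearr.
by rewrite !scalerDr !scalerA [a * _]mulrC addrACA.
Qed.
End BilinearRules.

Section MalgLift.
Variables (K : fieldType) (T : choiceType) (V : lmodType K).
Implicit Types f g : {malg K[T]}.

Definition malg_lift (h : T -> V) f : V := \sum_(k <- msupp f) f@_k *: h k.

Lemma malg_liftEw h (s : {fset T}) f : (msupp f `<=` s)%fset ->
  malg_lift h f = \sum_(k <- s) f@_k *: h k.
Proof.
by move=> le; rewrite /malg_lift; apply: big_fset_incl => // k _ /mcoeff_outdom ->; rewrite scale0r.
Qed.

Lemma malg_liftU h k : malg_lift h << k >> = h k.
Proof. by rewrite /malg_lift msuppU oner_eq0 big_seq_fset1 mcoeffUU scale1r. Qed.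

Fact malg_lift_linear h : linear (malg_lift h).
Proof.
move=> a f g; pose s := (msupp f `|` msupp g)%fset.
rewrite (@malg_liftEw h s f) ?fsubsetUl // (@malg_liftEw h s g) ?fsubsetUr //.
rewrite (@malg_liftEw h s); last first.
  by rewrite (fsubset_trans (msuppD_le _ _)) // fsetUSS // msuppZ_le.
rewrite scaler_sumr -big_split; apply: eq_bigr => k _ /=.
by rewrite mcoeffD mcoeffZ scalerDl scalerA.
Qed.
HB.instance Definition _ h :=
  GRing.isLinear.Build K {malg K[T]} V *:%R (malg_lift h) (malg_lift_linear h).
End MalgLift.

Lemma malg_scaleAr (K : comNzRingType) (T : monomType) (a : K) (f g : {malg K[T]}) :
  a *: (f * g) = f * (a *: g).
Proof.
apply/malgP => k; rewrite mcoeffZ mcoeffMl.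
rewrite (mcoeffMlw _ (fsubset_refl (msupp f)) (msuppZ_le a g)) mulr_sumr.
apply: eq_bigr => u _; rewrite mulr_sumr; apply: eq_bigr => v _.
by rewrite mcoeffZ mulrnAr mulrCA.
Qed.

Lemma malgUZ (K : nzRingType) (T : choiceType) (c : K) (k : T) :
  << c *g k >> = c *: << k >> :> {malg K[T]}.
Proof. by apply/malgP => l; rewrite mcoeffZ !mcoeffU mulrnAr mulr1. Qed.

(** The linear extension from words, [linext], is what makes the words linearly
    independent; with [word_span] it says that they form a basis. *)
Record free_algebra (K : fieldType) (I : choiceType) := FreeAlgebra {
  free_carrier :> algType K;
  word : seq I -> free_carrier;
  word_nil : word [::] = 1;
  word_cat : forall s t, word (s ++ t) = word s * word t;
  word_span : forall f : free_carrier, exists (c : seq I -> K) (S : seq (seq I)),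
    uniq S /\ f = \sum_(s <- S) c s *: word s;
  linext : forall V : lmodType K, (seq I -> V) -> {linear free_carrier -> V};
  linext_word : forall (V : lmodType K) (h : seq I -> V) s, linext h (word s) = h s
}.

Section FreeAlgebraConstruction.
Variables (K : fieldType) (I : choiceType).

Definition word_malg : Type := {malg K[{fmonom I}]}.
HB.instance Definition _ := GRing.Lalgebra.on word_malg.
HB.instance Definition _ :=
  GRing.Lalgebra_isAlgebra.Build K word_malg (@malg_scaleAr K {fmonom I}).

(** The algebra of the free monoid.  The proof is opaque on purpose: only the
    properties listed in the record are ever used, and products never unfold
    to finitely supported functions. *)
Lemma free_word_algebra : free_algebra K I.
Proof.
pose wd (s : seq I) : word_malg := << FMonom s >>.
apply: (@FreeAlgebra K I word_malg wd _ _ _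
         (fun V h => malg_lift (fun w : {fmonom I} => h (fmonom_val w)))).
- by congr (<< _ >>); rewrite [RHS]fmoneE.
- move=> s t; rewrite -[RHS]/(fgmul (wd s) (wd t)) /wd fgmulUU mulr1.
  by rewrite -(fmmulE (FMonom s) (FMonom t)).
- move=> f; exists (fun s => f@_(FMonom s)), (map (@fmonom_val I) (msupp f)).
  split; first by rewrite map_inj_uniq ?fset_uniq // => -[s] [t] /= ->.
  by rewrite big_map {1}[f]monalgE; apply: eq_bigr => -[s] _; apply: malgUZ.
- by move=> V h s; apply: (malg_liftU _ (FMonom s)).
Qed.
End FreeAlgebraConstruction.

Section FreeAlgebraTheory.
Variables (K : fieldType) (I : choiceType) (F : free_algebra K I).
Implicit Types f g : F.

Lemma free_algebra_ind (P : F -> Prop) :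
  P 0 -> (forall a f g, P f -> P g -> P (a *: f + g)) -> (forall s, P (word F s)) ->
  forall f, P f.
Proof.
move=> P0 Plin Pw f; have [c [S [_ ->]]] := word_span f.
by apply: big_rec => // s g _ Pg; apply: Plin.
Qed.

Section Eval.
Variables (A : algType K) (a : I -> A).

Definition ev : {linear F -> A} := linext F (fun s => \prod_(i <- s) a i).

Lemma ev_word s : ev (word F s) = \prod_(i <- s) a i.
Proof. exact: linext_word. Qed.

Lemma evM f g : ev (f * g) = ev f * ev g.
Proof.
elim/free_algebra_ind: f => [|b f f' IHf IHf'|u].
- by rewrite mul0r !linear0 mul0r.
- exact: multiplicative_linl.
elim/free_algebra_ind: g => [|b g g' IHg IHg'|v].
- by rewrite mulr0 linear0 mulr0.
- exact: multiplicative_linr.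
by rewrite -word_cat !ev_word big_cat.
Qed.
End Eval.

Definition augmentation : {scalar F} := ev (fun=> 0 : K^o).

Lemma augmentation_word s : augmentation (word F s) = (s == [::])%:R.
Proof. by rewrite /augmentation ev_word; case: s => [|i s]; rewrite ?big_nil // big_cons mul0r. Qed.

(** Left-handed Fox derivative: every [f] with zero constant term is the sum of
    the [word [:: j] * fox j f]. *)
Definition fox j : {linear F -> F} :=
  linext F (fun s => if s is i :: r then (if i == j then word F r else 0) else 0).

Lemma fox_word j s :
  fox j (word F s) = if s is i :: r then (if i == j then word F r else 0) else 0.
Proof. exact: linext_word. Qed.

Lemma foxM j f g : fox j (f * g) = fox j f * g + augmentation f *: fox j g.
Proof.
elim/free_algebra_ind: f => [|a f f' IHf IHf'|u].
- by rewrite mul0r !linear0 mul0r scale0r addr0.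
- exact: fox_rule_linl.
elim/free_algebra_ind: g => [|a g g' IHg IHg'|v].
- by rewrite mulr0 (linear0 (fox j)) mulr0 scaler0 addr0.
- exact: fox_rule_linr.
rewrite -word_cat !fox_word augmentation_word; case: u => [|i u] /=.
  by rewrite mul0r add0r scale1r.
by rewrite scale0r addr0; case: ifP; rewrite ?mul0r // word_cat.
Qed.
End FreeAlgebraTheory.

(** * A free Lie algebra embeds in the free associative algebra *)

Section FreeLieEmbedding.
Variables (K : fieldType) (charK0 : [pchar K] =i pred0) (m : nat).
Variables (L : lieAlgType K) (y : 'I_m -> L) (freeL : free_lie_algebra y).
Variables (F : free_algebra K 'I_m) (iota : {linear L -> F}).
Hypothesis iota_lie : forall u v, iota (lie u v) = iota u * iota v - iota v * iota u.
Hypothesis iota_y : forall i, iota (y i) = word F [:: i].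

Lemma augmentation_iota u : augmentation F (iota u) = 0.
Proof.
elim/(free_lie_ind freeL): u => [|a u v u0 v0|u v u0 v0|i].
- by rewrite !linear0.
- by rewrite !linearP u0 v0 /= mulr0 addr0.
- by rewrite iota_lie linearB !evM /= -!/(augmentation F _) u0 v0 mul0r subrr.
- by rewrite iota_y augmentation_word.
Qed.

Lemma fox_iota_lie j u v :
  fox F j (iota (lie u v)) = fox F j (iota u) * iota v - fox F j (iota v) * iota u.
Proof.
by rewrite iota_lie linearB /= !foxM !augmentation_iota !scale0r !addr0.
Qed.

(** The free algebra acts on [L] on the right, each generator by bracketing with
    it; this is the orbit map of [y j], so words go to left-normed brackets. *)
Definition bracket j : {linear F -> L} :=
  linext F (fun s => foldl (fun u i => lie u (y i)) (y j) s).

Lemma bracket_word j s :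
  bracket j (word F s) = foldl (fun u i => lie u (y i)) (y j) s.
Proof. exact: linext_word. Qed.

(** In this action [iota u] acts as the bracket with [u]: the Jacobi identity
    says that such elements [u] are closed under brackets. *)
Lemma bracketM j f u : bracket j (f * iota u) = lie (bracket j f) u.
Proof.
elim/(free_lie_ind freeL): u f => [|a u v IHu IHv|u v IHu IHv|i] f.
- by rewrite !linear0 mulr0 linear0.
- by rewrite !linearP /= mulrDr -scalerAr linearP /= IHu IHv.
- by rewrite iota_lie mulrBr !mulrA linearB /= !(IHu, IHv) -lie_lier.
elim/free_algebra_ind: f => [|a f g IHf IHg|s].
- by rewrite mul0r linear0 lie0l.
- by rewrite mulrDl -scalerAl !linearP /= lie_linearl IHf IHg.
by rewrite iota_y -word_cat !bracket_word foldl_cat.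
Qed.

(** The Dynkin operator.  As [iota u] has zero constant term it is the sum of
    the [word [:: j] * fox j (iota u)], and each word is replaced by its
    left-normed bracket. *)
Definition euler u : L := \sum_j bracket j (fox F j (iota u)).

Fact euler_linear : linear euler.
Proof.
move=> a u v; rewrite /euler scaler_sumr -big_split; apply: eq_bigr => j _ /=.
by rewrite !linearP.
Qed.
HB.instance Definition _ := GRing.isLinear.Build K L L *:%R euler euler_linear.

Lemma euler_lie u v : euler (lie u v) = lie (euler u) v - lie (euler v) u.
Proof.
rewrite /euler !lie_suml -sumrB; apply: eq_bigr => j _.
by rewrite fox_iota_lie linearB /= !bracketM.
Qed.

Lemma euler_y i : euler (y i) = y i.
Proof.
rewrite /euler (bigD1 i) //= big1 => [|j ne_ji].
  by rewrite iota_y fox_word eqxx bracket_word addr0.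
by rewrite iota_y fox_word eq_sym (negPf ne_ji) linear0.
Qed.

Lemma euler_bracket j s :
  euler (bracket j (word F s)) = (size s).+1%:R *: bracket j (word F s).
Proof.
elim/last_ind: s => [|s i IHs]; first by rewrite bracket_word /= euler_y scale1r.
have -> : bracket j (word F (rcons s i)) = lie (bracket j (word F s)) (y i).
  by rewrite !bracket_word foldl_rcons.
rewrite euler_lie IHs euler_y lieZl (lieC (y i)) opprK size_rcons.
by rewrite [in RHS]mulrS addrC scalerDl scale1r.
Qed.

Lemma bracket_surj u : exists f : 'I_m -> F, u = \sum_j bracket j (f j).
Proof.
elim/(free_lie_ind freeL): u => [|a u v [f ->] [g ->]|u v [f ->] _|i].
- by exists (fun=> 0); rewrite big1 // => j _; rewrite linear0.
- exists (fun j => a *: f j + g j); rewrite scaler_sumr -big_split.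
  by apply: eq_bigr => j _ /=; rewrite linearP.
- exists (fun j => f j * iota v); rewrite lie_suml; apply: eq_bigr => j _.
  by rewrite bracketM.
- exists (fun j => if i == j then word F [::] else 0).
  rewrite (bigD1 i) //= big1 => [|j ne_ji]; first by rewrite eqxx bracket_word addr0.
  by rewrite eq_sym (negPf ne_ji) linear0.
Qed.

(** The product of the [euler - k] for [1 <= k <= n]. *)
Fixpoint euler_prod n u : L :=
  if n is k.+1 then euler (euler_prod k u) - k.+1%:R *: euler_prod k u else u.

Lemma euler_prodP n a u v :
  euler_prod n (a *: u + v) = a *: euler_prod n u + euler_prod n v.
Proof.
elim: n => //= n ->; rewrite linearP /= scalerDr scalerBr opprD !scalerA [a * _]mulrC.
exact: addrACA.
Qed.

Lemma euler_prod0 n : euler_prod n 0 = 0.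
Proof. by elim: n => //= n ->; rewrite linear0 scaler0 subrr. Qed.

Lemma euler_prod_eigen n c u :
  euler u = c *: u -> euler_prod n u = (\prod_(k < n) (c - k.+1%:R)) *: u.
Proof.
move=> eu; elim: n => [|n IHn] /=; first by rewrite big_ord0 scale1r.
by rewrite IHn linearZ /= eu big_ord_recr /= !scalerA -scalerBl [n.+1%:R * _]mulrC -mulrBr.
Qed.

(** Every element is a combination of left-normed brackets, which are
    eigenvectors of [euler] for their lengths. *)
Lemma euler_prod_nil u : exists N, forall n, (N <= n)%N -> euler_prod n u = 0.
Proof.
have lin a v w : (exists N, forall n, (N <= n)%N -> euler_prod n v = 0) ->
    (exists N, forall n, (N <= n)%N -> euler_prod n w = 0) ->
    exists N, forall n, (N <= n)%N -> euler_prod n (a *: v + w) = 0.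
  move=> [N1 e1] [N2 e2]; exists (maxn N1 N2) => n.
  by rewrite geq_max euler_prodP => /andP[/e1-> /e2->]; rewrite scaler0 addr0.
have zero : exists N, forall n, (N <= n)%N -> euler_prod n 0 = 0.
  by exists 0%N => n _; apply: euler_prod0.
have [f ->] := bracket_surj u; elim/big_rec: _ => // j v _ Pv.
rewrite -[bracket _ _]scale1r; apply: (lin) => //.
elim/free_algebra_ind: (f j) => [|a g g' Pg Pg'|s]; first by rewrite linear0.
  by rewrite linearP /=; apply: lin.
exists (size s).+1 => n lt_sn.
rewrite (euler_prod_eigen n (euler_bracket j s)).
by rewrite (bigD1 (Ordinal lt_sn)) //= subrr mul0r scale0r.
Qed.

(** If [iota u = 0] then [u] is an eigenvector of [euler] for [0], so that
    [euler_prod n] multiplies it by [(-1) ^ n * n!], which is not zero. *)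
Lemma iota_inj u : iota u = 0 -> u = 0.
Proof.
move=> iu; have eu : euler u = 0 *: u.
  by rewrite scale0r /euler big1 // => j _; rewrite iu !linear0.
have [N /(_ N (leqnn N))] := euler_prod_nil u.
rewrite (euler_prod_eigen N eu) => /eqP; rewrite scaler_eq0 => /orP[|/eqP//].
move=> /prodf_eq0[k _].
by rewrite sub0r oppr_eq0 ((pcharf0P K).1 charK0).
Qed.
End FreeLieEmbedding.

(** * The skew polynomial algebra of a polynomial shift *)

Section ShiftAlgebra.
Variable K : fieldType.
Local Notation R := {poly K}.

Definition shift : R -> R := comp_poly ('X + 1%:P).
HB.instance Definition _ := GRing.LRMorphism.on shift.

Lemma shiftC a : shift a%:P = a%:P. Proof. exact: comp_polyC. Qed.

Lemma horner_shift p a : (shift p).[a] = p.[a + 1].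
Proof. by rewrite horner_comp hornerD hornerX hornerC. Qed.

Lemma size_shift p : size (shift p) = size p.
Proof. by rewrite size_comp_poly2 // size_XaddC. Qed.

Lemma shift_eq0 p : (shift p == 0) = (p == 0).
Proof. by rewrite -!size_poly_eq0 size_shift. Qed.

Lemma iter_shift_eq0 n p : (iter n shift p == 0) = (p == 0).
Proof. by elim: n => //= n <-; rewrite shift_eq0. Qed.

(** A finite difference lowers the degree: the leading terms cancel. *)
Lemma size_difference p : (size (shift p - p)%R <= (size p).-1)%N.
Proof.
have lead_shift : (shift p)`_(size p).-1 = p`_(size p).-1.
  have := @lead_coef_comp _ p ('X + 1%:P).
  by rewrite size_XaddC lead_coefXaddC expr1n mulr1 !lead_coefE -/(shift p) size_shift; apply.
apply/leq_sizeP => j; rewrite coefB leq_eqVlt => /predU1P[<-|lt_j].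
  by rewrite lead_shift subrr.
have le_j : (size p <= j)%N by case: (size p) lt_j.
by rewrite !nth_default ?subrr ?size_shift.
Qed.

(** Elements are polynomials in [t] with coefficients on the left, and this is
    left multiplication by [t]. *)
Definition mulT (f : {poly R}) : {poly R} := map_poly shift f * 'X.

Fact mulT_additive : zmod_morphism mulT.
Proof. by move=> f g; rewrite /mulT raddfB mulrBl. Qed.
HB.instance Definition _ := GRing.isZmodMorphism.Build {poly R} {poly R} mulT mulT_additive.

Lemma mulTZ c f : mulT (c *: f) = shift c *: mulT f.
Proof. by rewrite /mulT map_polyZ scalerAl. Qed.

Lemma iter_mulTZ n c f : iter n mulT (c *: f) = iter n shift c *: iter n mulT f.
Proof. by elim: n => //= n ->; rewrite mulTZ. Qed.

Lemma iter_mulTD n f g : iter n mulT (f + g) = iter n mulT f + iter n mulT g.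
Proof. by elim: n => //= n ->; rewrite raddfD. Qed.

Lemma coef_mulT f i : (mulT f)`_i = if i is j.+1 then shift f`_j else 0.
Proof. by rewrite coefMX; case: i => //= i; rewrite coef_map. Qed.

Lemma coef_iter_mulT n (f : {poly R}) i :
  (iter n mulT f)`_i = if (i < n)%N then 0 else iter n shift f`_(i - n).
Proof.
elim: n i => [|n IHn] i /=; first by rewrite subn0.
by rewrite coef_mulT; case: i => // i; rewrite IHn ltnS subSS; case: ifP; rewrite ?raddf0.
Qed.

Lemma mulTn1 n : iter n mulT 1 = 'X^n.
Proof.
by elim: n => //= n ->; rewrite /mulT map_polyXn exprSr.
Qed.

Definition skew_mul (f g : {poly R}) : {poly R} :=
  \sum_(i < size f) f`_i *: iter i mulT g.

Lemma skew_mulEw n (f g : {poly R}) : (size f <= n)%N ->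
  skew_mul f g = \sum_(i < n) f`_i *: iter i mulT g.
Proof.
move=> le_fn; rewrite /skew_mul (big_ord_widen _ (fun i => f`_i *: iter i mulT g) le_fn).
rewrite big_mkcond /=; apply: eq_bigr => i _; case: ltnP => // le_i.
by rewrite nth_default ?scale0r.
Qed.

Fact skew_mulDl : left_distributive skew_mul +%R.
Proof.
move=> f g h; pose n := maxn (size f) (size g).
rewrite (@skew_mulEw n (f + g)) ?size_polyD // (@skew_mulEw n f) ?leq_maxl //.
rewrite (@skew_mulEw n g) ?leq_maxr // -big_split; apply: eq_bigr => i _.
by rewrite coefD scalerDl.
Qed.

Fact skew_mulDr : right_distributive skew_mul +%R.
Proof.
move=> f g h; rewrite /skew_mul -big_split; apply: eq_bigr => i _.
by rewrite iter_mulTD scalerDr.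
Qed.

Lemma skew_mul0l f : skew_mul 0 f = 0.
Proof. by rewrite /skew_mul size_poly0 big_ord0. Qed.

Lemma skew_mulZl c f g : skew_mul (c *: f) g = c *: skew_mul f g.
Proof.
rewrite (@skew_mulEw (size f)) ?size_scale_leq // scaler_sumr.
by apply: eq_bigr => i _; rewrite coefZ scalerA.
Qed.

Lemma skew_mul_mulT f g : skew_mul (mulT f) g = mulT (skew_mul f g).
Proof.
rewrite (@skew_mulEw (size f).+1); last first.
  by apply/leq_sizeP => [[|j]] // le_fj; rewrite coef_mulT nth_default ?raddf0.
rewrite big_ord_recl coef_mulT scale0r add0r raddf_sum /=.
by apply: eq_bigr => i _; rewrite mulTZ coef_mulT.
Qed.

Lemma skew_mul_mulTn n f g : skew_mul (iter n mulT f) g = iter n mulT (skew_mul f g).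
Proof. by elim: n => //= n <-; rewrite skew_mul_mulT. Qed.

(** [skew_mul] is linear over the coefficients on the left, and commutes with left
    multiplication by [t]. *)
Fact skew_mulA : associative skew_mul.
Proof.
move=> f g h; rewrite [skew_mul f g]/skew_mul.
rewrite (big_morph (skew_mul^~ h) (fun x y => skew_mulDl x y h) (skew_mul0l h)).
by apply: eq_bigr => i _; rewrite skew_mulZl skew_mul_mulTn.
Qed.

Fact skew_mul1 : left_id 1 skew_mul.
Proof. by move=> f; rewrite /skew_mul size_poly1 big_ord1 coefC scale1r. Qed.

Fact skew_mulr1 : right_id 1 skew_mul.
Proof.
move=> f; rewrite -[RHS]coefK poly_def; apply: eq_bigr => i _.
by rewrite mulTn1.
Qed.

(** The product of the leading terms; both divisibility properties of
    [shift_alg] come from it. *)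
Lemma coef_skew_mul m n (f g : {poly R}) : (size f <= m.+1)%N -> (size g <= n.+1)%N ->
  (skew_mul f g)`_(m + n) = f`_m * iter m shift g`_n.
Proof.
move=> le_fm le_gn; rewrite (skew_mulEw _ le_fm) big_ord_recr /= coefD coef_sum.
rewrite big1 ?add0r => [|i _].
  by rewrite coefZ coef_iter_mulT ltnNge leq_addr addKn.
rewrite coefZ coef_iter_mulT; case: ifP; rewrite ?mulr0 // => _.
rewrite [g`__]nth_default //; last first.
  by rewrite (leq_trans le_gn) // ltn_subRL ltn_add2r.
have /eqP-> : iter i shift 0 == 0 by rewrite iter_shift_eq0.
by rewrite mulr0.
Qed.

Lemma skew_mulCr a f g : skew_mul f (a%:P *: g) = a%:P *: skew_mul f g.
Proof.
rewrite /skew_mul scaler_sumr; apply: eq_bigr => i _; rewrite iter_mulTZ.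
have -> : iter i shift a%:P = a%:P by elim: (nat_of_ord i) => //= n ->; rewrite shiftC.
by rewrite !scalerA mulrC.
Qed.

(** Skew polynomials over [K[X]]; the alias keeps their product apart from that
    of the commutative ring [{poly {poly K}}]. *)
Definition shift_alg : Type := {poly R}.
HB.instance Definition _ := GRing.Zmodule.on shift_alg.

Fact skew_mul1_neq0 : (1 : {poly R}) != 0. Proof. exact: oner_neq0. Qed.
HB.instance Definition _ := GRing.Zmodule_isNzRing.Build shift_alg
  skew_mulA skew_mul1 skew_mulr1 skew_mulDl skew_mulDr skew_mul1_neq0.

Definition shift_alg_scale (a : K) (f : shift_alg) : shift_alg := a%:P *: (f : {poly R}).

Fact shift_alg_scale_A a b v : shift_alg_scale a (shift_alg_scale b v) = shift_alg_scale (a * b) v.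
Proof. by rewrite /shift_alg_scale scalerA polyCM. Qed.

Fact shift_alg_scale_1 : left_id 1 shift_alg_scale.
Proof. by move=> v; rewrite /shift_alg_scale scale1r. Qed.

Fact shift_alg_scale_Dr : right_distributive shift_alg_scale +%R.
Proof. by move=> a u v; rewrite /shift_alg_scale scalerDr. Qed.

Fact shift_alg_scale_Dl v : {morph shift_alg_scale^~ v : a b / a + b}.
Proof. by move=> a b; rewrite /shift_alg_scale polyCD scalerDl. Qed.
HB.instance Definition _ := GRing.Zmodule_isLmodule.Build K shift_alg
  shift_alg_scale_A shift_alg_scale_1 shift_alg_scale_Dr shift_alg_scale_Dl.

Fact shift_alg_scale_Al a (u v : shift_alg) : a *: (u * v) = (a *: u) * v.
Proof. by symmetry; apply: skew_mulZl. Qed.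
HB.instance Definition _ := GRing.Lmodule_isLalgebra.Build K shift_alg shift_alg_scale_Al.

Fact shift_alg_scale_Ar a (u v : shift_alg) : a *: (u * v) = u * (a *: v).
Proof. by symmetry; apply: skew_mulCr. Qed.
HB.instance Definition _ := GRing.Lalgebra_isAlgebra.Build K shift_alg shift_alg_scale_Ar.

Lemma shift_alg_mul_eq0 (a b : shift_alg) : a * b = 0 -> a = 0 \/ b = 0.
Proof.
have [->|a0] := eqVneq a 0; first by left.
have [->|b0] := eqVneq b 0; first by right.
pose f : {poly R} := a; pose g : {poly R} := b => ab0.
have := @coef_skew_mul (size f).-1 (size g).-1 f g (leqSpred _) (leqSpred _).
rewrite [skew_mul f g]ab0 coef0 => /esym/eqP.
by rewrite mulf_eq0 iter_shift_eq0 !lead_coef_eq0 (negPf a0) (negPf b0).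
Qed.

(** A unit has degree [0] in [t], so it is a unit of [K[X]]. *)
Lemma shift_alg_unit (a b : shift_alg) : a * b = 1 -> exists c, a = c%:A.
Proof.
move=> ab1; pose f : {poly R} := a; pose g : {poly R} := b.
have fg1 : skew_mul f g = 1 by [].
have f0 : f != 0.
  by apply: contra_eq_neq fg1 => ->; rewrite skew_mul0l eq_sym oner_neq0.
have g0 : g != 0.
  apply: contra_eq_neq fg1 => ->; rewrite eq_sym.
  have -> : skew_mul f 0 = 0 by apply: (mulr0 (a : shift_alg)).
  exact: oner_neq0.
have := @coef_skew_mul (size f).-1 (size g).-1 f g (leqSpred _) (leqSpred _).
rewrite fg1 coef1; case: eqP => [/eqP|_]; last first.
  by move/esym/eqP; rewrite mulf_eq0 iter_shift_eq0 !lead_coef_eq0 (negPf f0) (negPf g0).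
rewrite addn_eq0 => /andP[/eqP sf _].
rewrite sf /= => /esym unit_f.
have /size_poly1P [c c0 fc] : size f`_0 == 1%N.
  have : f`_0 \is a GRing.unit by apply/unitrP; exists (iter 0 shift g`_(size g).-1); rewrite mulrC.
  by rewrite poly_unitE => /andP[].
exists c; rewrite -[RHS]/(c%:P *: (1 : {poly R}) : {poly R}).
by rewrite -mul_polyC mulr1 -fc; apply: size1_polyC; rewrite (polySpred f0) sf.
Qed.

Definition shift_monomial (p : R) n : shift_alg := p *: 'X^n.

Lemma shift_monomialM p q m n :
  shift_monomial p m * shift_monomial q n = shift_monomial (p * iter m shift q) (m + n).
Proof.
rewrite /shift_monomial -[in LHS]mulTn1.
rewrite [LHS]skew_mulZl skew_mul_mulTn [skew_mul _ _]skew_mul1 iter_mulTZ scalerA.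
by rewrite -!mulTn1 -iterD.
Qed.

Lemma shift_monomialB p q n :
  shift_monomial p n - shift_monomial q n = shift_monomial (p - q) n.
Proof. exact/esym/(scalerBl p q ('X^n : {poly R})). Qed.
End ShiftAlgebra.

(** * Representations in skew polynomials separate noncommutative polynomials *)

Section Separation.
Variables (K : fieldType) (charK0 : [pchar K] =i pred0).
Variables (I : choiceType) (i0 : I) (F : free_algebra K I).

(** The generator [i] is sent to [p i * t]. *)
Definition shift_eval (p : I -> {poly K}) : {linear F -> shift_alg K} :=
  ev F (fun i => shift_monomial (p i) 1).

Fixpoint shift_prod (p : I -> {poly K}) (w : seq I) : {poly K} :=
  if w is i :: v then p i * shift (shift_prod p v) else 1.

Lemma shift_eval_word p w :
  shift_eval p (word F w) = shift_monomial (shift_prod p w) (size w).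
Proof.
rewrite /shift_eval ev_word; elim: w => [|i w IHw] /=.
  by rewrite big_nil /shift_monomial scale1r expr0.
by rewrite big_cons IHw shift_monomialM.
Qed.

(** Each [t] to the left of a coefficient translates its argument by [1], so
    the [k]-th letter of a word contributes its polynomial at [k]; the offset
    [a] is there for the induction. *)
Lemma horner_shift_prod p w (a : nat) :
  (shift_prod p w).[a%:R] = \prod_(k < size w) (p (nth i0 w k)).[(a + k)%:R].
Proof.
elim: w a => [|i w IHw] a /=; first by rewrite hornerC big_ord0.
rewrite hornerM horner_shift natr1 IHw.
rewrite big_ord_recl addn0; congr (_ * _); apply: eq_bigr => k _ /=.
by rewrite addSnnS.
Qed.

Definition shift_coef n (f : shift_alg K) : K := ((f : {poly {poly K}})`_n).[0].

Fact shift_coef_linear n : linear_for *%R (shift_coef n).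
Proof.
move=> a f g.
rewrite /shift_coef -[a *: f + g]/((a%:P *: (f : {poly {poly K}}) + g) : {poly {poly K}}).
by rewrite coefD coefZ hornerD hornerM hornerC.
Qed.
HB.instance Definition _ n :=
  GRing.isLinear.Build K (shift_alg K) K *%R (shift_coef n) (shift_coef_linear n).

Lemma shift_coef_monomial n p k :
  shift_coef n (shift_monomial p k) = if k == n then p.[0] else 0.
Proof.
rewrite /shift_coef /shift_monomial coefZ coefXn eq_sym.
by case: eqP; rewrite ?mulr1 ?mulr0 ?horner0.
Qed.

(** An unnormalised interpolation polynomial: on [0, .., size w - 1] it vanishes
    outside the positions of the letter [i] in [w]. *)
Definition letter_poly (w : seq I) (i : I) : {poly K} :=
  \sum_(k < size w | nth i0 w k == i) \prod_(l < size w | l != k) ('X - l%:R%:P).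

Lemma horner_letter_poly w i (k : nat) : (k < size w)%N ->
  ((letter_poly w i).[k%:R] == 0) = (nth i0 w k != i).
Proof.
move=> lt_kw; pose k0 := Ordinal lt_kw.
have vanish (l : 'I_(size w)) : l != k0 ->
    (\prod_(l' < size w | l' != l) ('X - l'%:R%:P)).[k%:R] = 0 :> K.
  move=> ne_lk; rewrite horner_prod; apply/eqP/prodf_eq0; exists k0.
    by rewrite eq_sym.
  by rewrite hornerXsubC subrr.
rewrite /letter_poly horner_sum.
have [e|ne] := eqVneq (nth i0 w k) i; last first.
  rewrite big1 ?eqxx // => l /eqP el; apply: vanish.
  by apply: contraNneq ne => lk; rewrite -el lk.
rewrite (bigD1 k0) /=; last by rewrite e.
rewrite [X in _ + X]big1 => [|l /andP[_]]; last exact: vanish.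
rewrite addr0 horner_prod.
apply/negbTE/prodf_neq0 => l ne_lk; rewrite hornerXsubC subr_eq0.
apply: contraNneq ne_lk => e'; apply/eqP/val_inj => /=; apply/eqP; rewrite eq_sym.
have [le|/ltnW le] := leqP l k; have := (pcharf0P K).1 charK0.
  by move/(_ (k - l)%N); rewrite natrB // e' subrr eqxx => /esym; rewrite subn_eq0 eqn_leq => ->.
by move/(_ (l - k)%N); rewrite natrB // e' subrr eqxx => /esym; rewrite subn_eq0 eqn_leq => ->; rewrite le.
Qed.

(** For [shift_eval_separates]: the words that the polynomials chosen there do
    not kill come from [w] by turning letters into [i0], which can only
    increase the number of occurrences of [i0]. *)
Lemma count_max (w v : seq I) : size v = size w ->
  (forall k, (k < size w)%N -> nth i0 v k = i0 \/ nth i0 v k = nth i0 w k) ->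
  (count_mem i0 w <= count_mem i0 v)%N /\
  ((count_mem i0 v <= count_mem i0 w)%N -> v = w).
Proof.
elim: w v => [|i w IHw] [|j v] //= [sz] H.
have [k lt_kw|le inj] := IHw v sz; first exact: (H k.+1).
case: (H 0%N isT) => /= ->; last first.
  by rewrite leq_add2l; split=> //; rewrite leq_add2l => /inj ->.
rewrite eqxx; split; first by rewrite leq_add ?leq_b1.
case: eqVneq => [->|_] /=; first by rewrite leq_add2l => /inj ->.
by rewrite add0n add1n ltnNge le.
Qed.

(** Choose a word [w] of the support of [f] with the largest number of letters
    [i0], and let the other letters be sent to their [letter_poly].  Among the
    words of the support, only [w] contributes to the constant term of the
    coefficient of [t ^ size w]: another word that contributes would contain
    [i0] more often than [w]. *)
Lemma shift_eval_separates f : f != 0 ->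
  exists p : I -> {poly K}, p i0 = 1 /\ shift_eval p f != 0.
Proof.
have [c [S [uS ->]]] := word_span f => nz.
pose T := [seq w <- S | c w != 0].
have Tnil : T != [::].
  apply: contraNneq nz => T0; rewrite big_seq big1 // => w wS.
  have : w \notin T by rewrite T0.
  by rewrite mem_filter wS andbT negbK => /eqP->; rewrite scale0r.
have [w wT wmax] : exists2 w, w \in T &
    forall v, v \in T -> (count_mem i0 v <= count_mem i0 w)%N.
  elim: T Tnil => // v [|u T] IH _.
    by exists v; rewrite ?mem_head // => v'; rewrite inE => /eqP->.
  have [//|w wT wmax] := IH.
  case: (leqP (count_mem i0 v) (count_mem i0 w)) => le.
    by exists w; [rewrite inE wT orbT|move=> v' /[!inE] /predU1P[->//|/wmax]].
  exists v; rewrite ?mem_head // => v' /[!inE] /predU1P[->//|/wmax le'].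
  exact: leq_trans le' (ltnW le).
pose p i := if i == i0 then 1 else letter_poly w i.
exists p; split; first by rewrite /p eqxx.
apply: contraTneq (wT) => ev0; have := congr1 (shift_coef (size w)) ev0.
have wS : w \in S by move: wT; rewrite mem_filter => /andP[].
rewrite linear0 !linear_sum (bigD1_seq w) //= big1_seq => [|v /andP[ne_vw vS]]; last first.
  rewrite !linearZ /= shift_eval_word shift_coef_monomial.
  case: eqP => [sz|_]; last by rewrite mulr0.
  have [->|cv] := eqVneq (c v) 0; first by rewrite mul0r.
  rewrite (horner_shift_prod p v 0); apply/eqP; rewrite mulf_eq0; apply/orP; right.
  apply: contraNT ne_vw => /prodf_neq0 nzv; apply/eqP.
  have [k lt_kw|_] := @count_max w v sz; last first.
    by apply; apply: wmax; rewrite mem_filter cv.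
  have lt_kv : (k < size v)%N by rewrite sz.
  have := nzv (Ordinal lt_kv) isT; rewrite /p add0n /=.
  case: (eqVneq (nth i0 v k)) => [e _|_]; first by left.
  by rewrite horner_letter_poly // negbK => /eqP->; right.
rewrite addr0 !linearZ /= shift_eval_word shift_coef_monomial eqxx.
rewrite (horner_shift_prod p w 0) => /eqP; rewrite mulf_eq0 => /orP[/eqP cw|].
  by rewrite mem_filter cw eqxx.
case/prodf_eq0 => k _; rewrite /p add0n; case: (eqVneq (nth i0 w k)) => _; first by rewrite hornerC oner_eq0.
by rewrite horner_letter_poly // eqxx.
Qed.
End Separation.

(** * Normal automorphisms and representations in a domain with scalar units *)

(** The normality of [phi] is tested on the ideals formed by the [u] with
    [rho u = 0] and [d u] in a right ideal of [A]: for the principal right ideal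
    of [d u] this makes [d (phi u)] a right multiple of [d u], and for that of
    [d (phi u)] it gives the converse. *)
Lemma normal_automorphism_fixes_image (K : fieldType) (L : lieAlgType K)
    (A : algType K) (rho d : {linear L -> A}) (phi : {linear L -> L}) (u0 : L) :
  (forall a b : A, a * b = 0 -> a = 0 \/ b = 0) ->
  (forall a b : A, a * b = 1 -> exists c : K, a = c%:A) ->
  (forall x y, rho (lie x y) = rho x * rho y - rho y * rho x) ->
  (forall x y, d (lie x y) = d x * rho y - d y * rho x) ->
  normal_automorphism phi -> rho u0 = 0 -> d u0 != 0 ->
  forall x, rho (phi x) = rho x.
Proof.
move=> domA unitA rho_lie d_lie [[phi_lie phi_bij] phi_normal] ru0 du0.
have phi_inj := bij_inj phi_bij.
have phi_ideal I u : lie_ideal I -> I u <-> I (phi u).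
  move=> idI; rewrite -{2}(phi_normal I idI); split=> [Iu|]; first by exists u.
  by case=> v Iv /phi_inj <-.
have ker_ideal (S : set A) : S 0 ->
    (forall (c : K) a b, S a -> S b -> S (c *: a + b)) ->
    (forall a b, S a -> S (a * b)) ->
    lie_ideal [set u | rho u = 0 /\ S (d u)]%classic.
  move=> S0 Slin Smul.
  have SN a : S a -> S (- a).
    by move=> Sa; rewrite -scaleN1r -[_ *: a]addr0; apply: Slin.
  split=> /= [|c u v [ru Su] [rv Sv]|x u [ru Su]]; first by rewrite !linear0.
    by rewrite !linearP ru rv scaler0 addr0; split=> //; apply: Slin.
  rewrite !rho_lie !d_lie ru !mulr0 !mul0r !subrr sub0r subr0.
  by split; split=> //; [apply: SN|]; apply: Smul.
have phi_ker u : rho u = 0 -> rho (phi u) = 0.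
  move=> ru; pose S : set A := [set: A]%classic.
  by have [//|] := (phi_ideal _ u (ker_ideal S I (fun _ _ _ _ _ => I) (fun _ _ _ => I))).1.
have divides u v : rho u = 0 -> rho v = 0 ->
    (forall I, lie_ideal I -> I u -> I v) -> exists a, d v = d u * a.
  move=> ru rv Iuv; pose S : set A := [set a | exists b, a = d u * b]%classic.
  suff /Iuv[] : lie_ideal [set u | rho u = 0 /\ S (d u)]%classic => //=.
    by split=> //; exists 1; rewrite mulr1.
  apply: ker_ideal => /= [|c _ _ [a ->] [b ->]|_ b [a ->]].
  - by exists 0; rewrite mulr0.
  - by exists (c *: a + b); rewrite mulrDr scalerAr.
  - by exists (a * b); rewrite mulrA.
have cancel_d u (a b : A) : d u != 0 -> d u * a = d u * b -> a = b.
  move=> du /eqP; rewrite -subr_eq0 -mulrBr => /eqP /domA[/eqP|/eqP].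
    by rewrite (negPf du).
  by rewrite subr_eq0 => /eqP.
have scalar u : rho u = 0 -> exists c : K, d (phi u) = c *: d u.
  move=> ru.
  have [a da] := divides _ _ ru (phi_ker u ru) (fun I idI => (phi_ideal I u idI).1).
  have [du|du] := eqVneq (d u) 0; first by exists 0; rewrite da du mul0r scaler0.
  have [b db] := divides _ _ (phi_ker u ru) ru (fun I idI => (phi_ideal I u idI).2).
  have /unitA[c ac] : a * b = 1.
    by apply: (cancel_d u) => //; rewrite mulrA -da -db mulr1.
  by exists c; rewrite da ac -scalerAr mulr1.
have [c0 dc0] := scalar _ ru0.
have c0_neq0 : c0 != 0.
  apply: contraNneq du0 => c00; move: dc0; rewrite c00 scale0r => dphi.
  have [b ->] := divides _ _ (phi_ker _ ru0) ru0 (fun I idI => (phi_ideal I u0 idI).2).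
  by rewrite dphi mul0r.
(* The eigenvalue on [u0] is the eigenvalue on every [u]: directly if [d u] is a
   multiple of [d u0], otherwise by considering [u0 + u]. *)
have colinear u l : rho u = 0 -> d u = l *: d u0 -> d (phi u) = c0 *: d u.
  move=> ru dul; have [|c] := scalar (u - l *: u0).
    by rewrite linearB linearZ /= ru ru0 scaler0 subrr.
  have -> : d (u - l *: u0) = 0 by rewrite linearB linearZ /= dul subrr.
  have -> : phi (u - l *: u0) = phi u - l *: phi u0 by rewrite linearB linearZ.
  rewrite linearB linearZ /= dc0 dul scaler0 => /eqP.
  by rewrite subr_eq0 => /eqP ->; rewrite !scalerA mulrC.
have global u : rho u = 0 -> d (phi u) = c0 *: d u.
  move=> ru; have [c dc] := scalar _ ru.
  have [e] : exists c : K, d (phi (u0 + u)) = c *: d (u0 + u).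
    by apply: scalar; rewrite linearD ru0 ru addr0.
  rewrite !linearD dc dc0 /= => /eqP; rewrite -subr_eq0 opprD addrACA -!scalerBl.
  have [<-|ne_ce] := eqVneq c e.
    rewrite subrr scale0r addr0 scaler_eq0 (negPf du0) orbF subr_eq0 => /eqP c0c.
    by rewrite c0c.
  rewrite addrC addr_eq0 => /eqP dul.
  rewrite -dc; apply: (@colinear u (- ((c - e)^-1 * (c0 - e)))) => //.
  rewrite scaleNr -scalerA -scalerN -dul scalerA mulVf ?scale1r //.
  by rewrite subr_eq0.
move=> x; have := global (lie u0 x).
rewrite phi_lie !d_lie !rho_lie ru0 (phi_ker _ ru0) mul0r mulr0 subrr => /(_ erefl).
rewrite !mulr0 !subr0 dc0 -!scalerAl => /(scalerI c0_neq0).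
exact: cancel_d.
Qed.

(** * The skew polynomial representations of a free Lie algebra *)

Section KernelElement.
Variables (K : fieldType) (L : lieAlgType K) (I : choiceType) (y : I -> L).
Variables (F : free_algebra K I) (iota : {linear L -> F}).
Hypothesis iota_lie : forall u v, iota (lie u v) = iota u * iota v - iota v * iota u.
Hypothesis iota_y : forall i, iota (y i) = word F [:: i].
Hypothesis fox_lie : forall j u v,
  fox F j (iota (lie u v)) = fox F j (iota u) * iota v - fox F j (iota v) * iota u.
Variables (p : I -> {poly K}) (i0 i1 : I).
Hypotheses (p_i0 : p i0 = 1) (i1_i0 : i1 != i0).

Definition shift_rep : {linear L -> shift_alg K} := shift_eval F p \o iota.
Definition shift_fox : {linear L -> shift_alg K} := shift_eval F p \o (fox F i1 \o iota).

Lemma shift_rep_lie u v :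
  shift_rep (lie u v) = shift_rep u * shift_rep v - shift_rep v * shift_rep u.
Proof. by rewrite /= iota_lie linearB /= !evM. Qed.

Lemma shift_fox_lie u v :
  shift_fox (lie u v) = shift_fox u * shift_rep v - shift_fox v * shift_rep u.
Proof. by rewrite /= fox_lie linearB /= !evM. Qed.

Lemma shift_rep_y i : shift_rep (y i) = shift_monomial (p i) 1.
Proof. by rewrite /= iota_y shift_eval_word /= [shift 1]rmorph1 mulr1. Qed.

Lemma shift_fox_y i : shift_fox (y i) = if i == i1 then 1 else 0.
Proof.
rewrite /= iota_y fox_word; case: ifP => _; last by rewrite linear0.
by rewrite word_nil -(word_nil F) shift_eval_word /= /shift_monomial scale1r expr0.
Qed.

(** Bracketing with [y i0] will be nilpotent in the image of [shift_rep], so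
    these left-normed brackets eventually fall into its kernel. *)
Definition engel n := iter n (fun u => lie u (y i0)) (y i1).

(** As [p i0 = 1], bracketing with [y i0] is sent to the commutator with [t],
    which takes [q * t ^ k] to [(q - shift q) * t ^ (k + 1)]. *)
Lemma shift_rep_engel n :
  shift_rep (engel n) = shift_monomial (iter n (fun q => q - shift q) (p i1)) n.+1.
Proof.
elim: n => [|n IHn]; first exact: shift_rep_y.
rewrite [engel _]/= shift_rep_lie -/(engel n) IHn shift_rep_y p_i0 !shift_monomialM.
have -> : iter n.+1 (@shift K) 1 = 1 by elim: n.+1 => //= k ->; rewrite [shift 1]rmorph1.
by rewrite mulr1 mul1r addn1 add1n shift_monomialB.
Qed.

Lemma shift_fox_engel n : shift_fox (engel n) = shift_monomial 1 n.
Proof.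
elim: n => [|n IHn].
  by rewrite shift_fox_y eqxx /shift_monomial scale1r expr0.
rewrite [engel _]/= shift_fox_lie -/(engel n) IHn shift_fox_y eq_sym (negPf i1_i0).
rewrite mul0r subr0 shift_rep_y p_i0 shift_monomialM addn1 mul1r.
by have -> : iter n (@shift K) 1 = 1 by elim: n {IHn} => //= k ->; rewrite [shift 1]rmorph1.
Qed.

Lemma shift_rep_kernel : exists u, shift_rep u = 0 /\ shift_fox u != 0.
Proof.
exists (engel (size (p i1))); rewrite shift_rep_engel shift_fox_engel; split.
  have : (size (iter (size (p i1)) (fun q => (q - shift q)%R) (p i1)) <=
      size (p i1) - size (p i1))%N.
    elim: {1 3}(size (p i1)) => [|n IHn] /=; first by rewrite subn0.
    rewrite -opprB size_polyN (leq_trans (size_difference _)) //.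
    by rewrite subnS -!subn1 leq_sub2r.
  rewrite subnn leqn0 size_poly_eq0 => /eqP->.
  by rewrite /shift_monomial scale0r.
by rewrite /shift_monomial scale1r -size_poly_eq0 size_polyXn.
Qed.
End KernelElement.

Theorem theorem1p6 (K : fieldType) (charK0 : [pchar K] =i pred0)
    (m : nat) (m_ge2 : (2 <= m)%N)
    (L : lieAlgType K) (y : 'I_m -> L) (freeL : free_lie_algebra y)
    (phi : {linear L -> L}) :
  normal_automorphism phi <-> phi =1 id.
Proof.
split=> [phi_normal x|phi_id]; last first.
  split=> [|I _]; first by split=> [u v|]; [rewrite !phi_id|exists id].
  apply/seteqP; split=> [_ [u Iu <-]|u Iu]; rewrite ?phi_id //.
  by exists u; rewrite ?phi_id.
(* An element killed by every representation is killed by [iota], hence is 0. *)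
pose F := free_word_algebra K 'I_m.
have [iota [iota_lie iota_y] _] := freeL (commutator_algebra F) (fun i => word F [:: i]).
pose i0 := Ordinal (leq_trans (isT : 0 < 2)%N m_ge2); pose i1 := Ordinal m_ge2.
apply/eqP; rewrite -subr_eq0; apply/eqP.
apply: (@iota_inj K charK0 m L y freeL F iota iota_lie iota_y).
apply/eqP/negP => /negP.
move=> /(shift_eval_separates charK0 i0) [p [p_i0]].
have fox_lie := fox_iota_lie freeL iota_lie iota_y.
have [u [ru du]] := @shift_rep_kernel K L _ y F iota iota_lie iota_y fox_lie p i0 i1 p_i0 isT.
have := @normal_automorphism_fixes_image K L (shift_alg K)
   (shift_rep iota p) (shift_fox iota p i1) phi u
   (@shift_alg_mul_eq0 K) (@shift_alg_unit K)
   (shift_rep_lie iota_lie p) (shift_fox_lie fox_lie p i1)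
   phi_normal ru du x.
by rewrite /= linearB /= linearB /= => ->; rewrite subrr eqxx.
Qed.
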